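(* There exists a universal $\delta>0$ such that the following holds for all sufficiently large $n\in\mathbb{N}$. Let $\mathcal{H}$ be the collection of all graphs on $[n]$ and let $a:\mathcal{H}\to\mathbb{R}_{\ge0}$ satisfy \[\sum_{H\in\mathcal{H}}a(H)\exp\left(-\delta e(H)/\sqrt{n}\right)<\frac12.\] Then there is a triangle-free graph $G$ on $[n]$ such that $\sum_{H\in\mathcal{G}(G)}a(H)<1$, where $\mathcal{G}(G)=\{H\in\mathcal{H}: G\cap H=\emptyset\}$ is the set of graphs sharing no edge with $G$.
   Context: $e(H)$ denotes the number of edges of $H$. *)

(* Defs.v *)
From HB Require Import structures.
From mathcomp Require Import all_boot.
Set Implicit Arguments.
Unset Strict Implicit.
Unset Printing Implicit Defensive.

(* A graph on [n] is identified with its edge set, each edge being a 2-element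
   subset of the vertex set 'I_n. *)
Record sgraph (n : nat) := SGraph {
  edges :> {set {set 'I_n}};
  _ : [forall e in edges, #|e| == 2]
}.

HB.instance Definition _ n := [isSub for @edges n].
HB.instance Definition _ n := [Finite of sgraph n by <:].

Definition nb_edges n (H : sgraph n) : nat := #|edges H|.

(* Edges have two elements, so x, y, z are automatically distinct in a
   triangle. *)
Definition is_triangle n (G : sgraph n) (x y z : 'I_n) : bool :=
  [&& [set x; y] \in edges G, [set y; z] \in edges G & [set x; z] \in edges G].

Definition triangle_free n (G : sgraph n) : Prop :=
  forall x y z : 'I_n, ~~ is_triangle G x y z.

Definition edge_disjoint n (G H : sgraph n) : bool :=
  edges G :&: edges H == set0.

(* Main.v *)
(* Keep each edge with probability p = 1/(10 sqrt n) and delete the edges of a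
   maximal edge-disjoint family M of triangles (Krivelevich); the result G is
   triangle-free.  If G misses H, each surviving edge of H lies in one of the
   T members of M that meet H, so the number X of surviving edges of H is at
   most 3T.  Hence either X <= p e(H)/4 or T >= p e(H)/12.  Both have
   exponentially small probability: E[exp(-X)] is a product, and expanding
   exp(T) = sum_(S in M_H) (exp 1 - 1)^|S| bounds E[exp(T)] by a product over
   the at most n e(H) triangles meeting H, since members of S are disjoint.
   Averaging sum a(H) [G misses H] over the random graph concludes. *)
Require Import Defs.
From mathcomp Require Import all_boot all_order all_algebra.
From mathcomp Require Import reals sequences exp.
From mathcomp Require Import lra ring.
Import Order.TTheory GRing.Theory Num.Theory.
Local Open Scope ring_scope.
Set Implicit Arguments.
Unset Strict Implicit.
Unset Printing Implicit Defensive.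

(** * Random subsets with independent elements *)

Lemma sum_expr_card_subset (R : comNzRingType) (T : finType) (k : R)
    (S : {set T}) :
  \sum_(A : {set T} | A \subset S) k ^+ #|A| = (1 + k) ^+ #|S|.
Proof.
have -> : (1 + k) ^+ #|S| = \prod_(x : T) ((if x \in S then k else 0) + 1).
  rewrite -prodr_const big_mkcond /=; apply: eq_bigr => x _.
  by case: ifP => _; rewrite ?add0r // addrC.
rewrite bigA_distr big_mkcond /=; apply: eq_bigr => A _.
case: ifPn => [/subsetP sAS | /subsetPn[x xA xNS]].
  rewrite -prodr_const big_mkcond /=; apply: eq_bigr => x _.
  by case: ifPn => // /sAS ->.
by rewrite (bigD1 x) //= xA (negPf xNS) mul0r.
Qed.

(** Probability that the random subset keeping each element of [T] independently with probability
    [p] equals [B]. *)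
Definition bernoulli_weight (R : comNzRingType) (T : finType) (p : R)
    (B : {set T}) : R :=
  \prod_(x : T) (if x \in B then p else 1 - p).

Lemma bernoulli_weight_ge0 (R : realDomainType) (T : finType) (p : R)
    (B : {set T}) : 0 <= p <= 1 -> 0 <= bernoulli_weight p B.
Proof.
by move=> /andP[p0 p1]; apply: prodr_ge0 => x _; case: ifP => _; rewrite ?subr_ge0.
Qed.

(** The expectation factors over elements: each one in [H] contributes [1 - p + p * y], any other
    contributes [1]. *)
Lemma bernoulli_weight_expr (R : comNzRingType) (T : finType) (p y : R)
    (H : {set T}) :
  \sum_(B : {set T}) bernoulli_weight p B * y ^+ #|B :&: H|
    = (1 - p + p * y) ^+ #|H|.
Proof.
have -> : (1 - p + p * y) ^+ #|H|
    = \prod_(x : T) ((if x \in H then p * y else p) + (1 - p)).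
  rewrite -prodr_const big_mkcond /=; apply: eq_bigr => x _.
  by case: ifP => _; [rewrite addrC | rewrite addrC subrK].
rewrite bigA_distr; apply: eq_bigr => B _.
rewrite -prodr_const [X in _ * X]big_mkcond -big_split /=.
apply: eq_bigr => x _; rewrite inE.
by case: (x \in B); case: (x \in H); rewrite /= ?mulr1.
Qed.

Lemma bernoulli_weight_superset (R : comNzRingType) (T : finType) (p : R)
    (S : {set T}) :
  \sum_(B : {set T} | S \subset B) bernoulli_weight p B = p ^+ #|S|.
Proof.
have -> : p ^+ #|S| = \prod_(x : T) (p + (if x \in S then 0 else 1 - p)).
  rewrite -prodr_const big_mkcond /=; apply: eq_bigr => x _.
  by case: ifP => _; [rewrite addr0 | rewrite addrC subrK].
rewrite bigA_distr big_mkcond /=; apply: eq_bigr => B _.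
case: ifPn => [/subsetP sSB | /subsetPn[x xS xNB]].
  by apply: eq_bigr => x _; case: ifPn => // /(contra (sSB x))/negPf ->.
by rewrite [RHS](bigD1 x) //= (negPf xNB) xS mul0r.
Qed.

Lemma sum_bernoulli_weight (R : comNzRingType) (T : finType) (p : R) :
  \sum_(B : {set T}) bernoulli_weight p B = 1.
Proof.
rewrite -[RHS](expr0 p) -(cards0 T) -bernoulli_weight_superset.
by apply: eq_bigl => B; rewrite sub0set.
Qed.

(** * Maximal packings and pruning *)

Definition packing (T : finType) (F : {set {set T}}) (B : {set T})
    (S : {set {set T}}) : bool :=
  [&& S \subset F, trivIset S & cover S \subset B].

Lemma packing0 (T : finType) (F : {set {set T}}) (B : {set T}) :
  packing F B set0.
Proof.
by rewrite /packing sub0set /trivIset /cover !big_set0 cards0 eqxx sub0set.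
Qed.

Definition max_packing (T : finType) (F : {set {set T}}) (B : {set T}) :
    {set {set T}} :=
  s2val (maxset_exists (packing0 F B)).

Lemma max_packingP (T : finType) (F : {set {set T}}) (B : {set T}) :
  maxset (packing F B) (max_packing F B).
Proof. exact: s2valP (maxset_exists (packing0 F B)). Qed.

Definition prune (T : finType) (F : {set {set T}}) (B : {set T}) : {set T} :=
  B :\: cover (max_packing F B).

Definition meeting (T : finType) (F : {set {set T}}) (H : {set T}) :
    {set {set T}} :=
  [set t in F | ~~ [disjoint t & H]].

(** A member of [F] inside the pruned set would be disjoint from every chosen one and could be
    added, against maximality; being nonempty, it is not itself chosen. *)
Lemma prune_free (T : finType) (F : {set {set T}}) (B t : {set T}) :
  t \in F -> t != set0 -> ~~ (t \subset prune F B).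
Proof.
move=> tF t0; apply/negP => tB.
have /maxsetP[/and3P[MF Mtriv MB] Mmax] := max_packingP F B.
move: tB; rewrite /prune subsetD => /andP[tB tM].
have tNM : t \notin max_packing F B.
  apply: contra t0 => tinM; rewrite -subset0 -(disjoint_setI0 tM) subsetI subxx.
  by apply: (bigcup_max t).
suff P : packing F B (t |: max_packing F B).
  have /setP/(_ t) := Mmax _ P (subsetUr _ _).
  by rewrite setU11 (negPf tNM).
apply/and3P; split.
- by rewrite subUset sub1set tF.
- apply/trivIsetP => A A'; rewrite !inE.
  have dis C : C \in max_packing F B -> [disjoint t & C].
    by move=> CM; apply: disjointWr tM; apply: (bigcup_max C).
  move=> /predU1P[->|AM] /predU1P[->|A'M]; rewrite ?eqxx // => neq.
  + exact: dis.
  + by rewrite disjoint_sym; apply: dis.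
  + exact: (trivIsetP Mtriv).
- by rewrite /cover bigcup_setU big_set1 subUset tB.
Qed.

(** Pruning removed all of [B :&: H], so each of its elements lies in a chosen member, which
    therefore meets [H]. *)
Lemma card_setI_prune_disjoint (T : finType) (F : {set {set T}}) (k : nat)
    (B H : {set T}) :
  (forall t, t \in F -> (#|t| <= k)%N) -> prune F B :&: H = set0 ->
  (#|B :&: H| <= k * #|meeting (max_packing F B) H|)%N.
Proof.
move=> Fk B0; set M := max_packing F B.
have /maxsetP[/and3P[/subsetP MF _ _] _] := max_packingP F B.
apply: (@leq_trans #|cover (meeting M H)|).
  apply/subset_leq_card/subsetP => x /setIP[xB xH].
  have : x \in cover M.
    apply: contraT => xM; have : x \in prune F B :&: H by rewrite !inE xM xB xH.
    by rewrite B0 inE.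
  case/bigcupP => t tM xt; apply/bigcupP; exists t => //.
  by rewrite inE tM; apply/pred0Pn; exists x; rewrite /= xt xH.
apply: leq_trans (leq_card_cover _).1 _.
apply: (@leq_trans (\sum_(t in meeting M H) k)).
  by apply: leq_sum => t; rewrite inE => /andP[/MF/Fk].
by rewrite sum_nat_const mulnC.
Qed.

(** Expanding [K = 1 + (K - 1)] gives a sum over subfamilies [S] of the chosen family; the
    dependence on the choice is then relaxed to [cover S \subset B]. *)
Lemma bernoulli_weight_max_packing (R : realDomainType) (T : finType)
    (F : {set {set T}}) (k : nat) (p K : R) (H : {set T}) :
  0 <= p <= 1 -> 1 <= K -> (forall t, t \in F -> #|t| = k) ->
  \sum_(B : {set T})
      bernoulli_weight p B * K ^+ #|meeting (max_packing F B) H|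
    <= (1 + (K - 1) * p ^+ k) ^+ #|meeting F H|.
Proof.
move=> p01 K1 Fk; have /andP[p0 _] := p01.
have K0 : 0 <= K - 1 by rewrite subr_ge0.
pose Q (S : {set {set T}}) := (S \subset meeting F H) && trivIset S.
apply: (@le_trans _ _ (\sum_(B : {set T}) \sum_(S | Q S && (cover S \subset B))
    bernoulli_weight p B * (K - 1) ^+ #|S|)).
  apply: ler_sum => B _; rewrite -mulr_sumr.
  apply: ler_wpM2l; first exact: bernoulli_weight_ge0.
  rewrite -[K in K ^+ _](subrKC 1) -sum_expr_card_subset.
  have /maxsetP[/and3P[MF Mtriv MB] _] := max_packingP F B.
  rewrite [X in _ <= X](bigID (fun S : {set {set T}} => S \subset meeting (max_packing F B) H)) /=.
  rewrite -[X in X <= _]addr0; apply: lerD; last first.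
    by apply: sumr_ge0 => S _; apply: exprn_ge0.
  rewrite le_eqVlt; apply/orP; left; apply/eqP; apply: eq_bigl => S.
  case SM : (S \subset _); rewrite ?andbF // andbT; symmetry.
  have SM' : S \subset max_packing F B.
    by apply: subset_trans SM _; apply/subsetP => t; rewrite inE => /andP[].
  rewrite /Q (trivIsetS SM' Mtriv) andbT; apply/andP; split.
    apply/subsetP => t /(subsetP SM); rewrite !inE => /andP[tM ->].
    by rewrite (subsetP MF).
  apply: subset_trans MB; apply/bigcupsP => t tS.
  by apply: (bigcup_max t) => //; apply: (subsetP SM').
rewrite (exchange_big_dep Q) /=; last by move=> B S _ /andP[].
(* Admitting non-disjoint families as well lets the sum fold back into a power. *)
rewrite -sum_expr_card_subset [X in _ <= X](bigID (@trivIset T)) /=.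
rewrite -[X in X <= _]addr0; apply: lerD; last first.
  by apply: sumr_ge0 => S _; rewrite exprn_ge0 // mulr_ge0 ?exprn_ge0.
apply: ler_sum => S /andP[SF Striv]; rewrite -mulr_suml.
under eq_bigl => B do rewrite /Q SF Striv /=.
(* By disjointness [cover S] has [k * #|S|] elements. *)
rewrite bernoulli_weight_superset -(eqP Striv).
under eq_bigr => t tS.
  have /(subsetP SF) : t \in S by []; rewrite inE => /andP[/Fk -> _]; over.
by rewrite sum_nat_const exprMn -exprM mulnC [(k * _)%N]mulnC mulrC.
Qed.

(** Each member meeting [H] is counted at an element of [H] that it contains. *)
Lemma card_meeting_le (T : finType) (F : {set {set T}}) (d : nat)
    (H : {set T}) :
  (forall x, (#|[set t in F | x \in t]| <= d)%N) ->
  (#|meeting F H| <= d * #|H|)%N.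
Proof.
move=> Fd; apply: (@leq_trans #|\bigcup_(x in H) [set t in F | x \in t]|).
  apply/subset_leq_card/subsetP => t; rewrite inE => /andP[tF /pred0Pn[x /andP[xt xH]]].
  by apply/bigcupP; exists x => //; rewrite inE tF.
have le_card (A B : {set {set T}}) : (#|A :|: B| <= #|A| + #|B|)%N.
  by rewrite cardsU leq_subr.
apply: (@leq_trans (\sum_(x in H) #|[set t in F | x \in t]|)).
  elim/big_rec2: _ => [|x m A _ Am]; first by rewrite cards0.
  by apply: leq_trans (le_card _ _) _; rewrite leq_add2l.
apply: (@leq_trans (\sum_(x in H) d)); first exact: leq_sum.
by rewrite sum_nat_const mulnC.
Qed.

(** * Exponential bound on the probability of missing [H] *)

Lemma expR1_le4 (R : realType) : expR 1 <= 4 :> R.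
Proof.
have h : 1 / 2 <= expR (- (1 / 2)) :> R.
  by apply: le_trans (expR_ge1Dx _); lra.
have e : expR (1 / 2) <= 2 :> R.
  by rewrite -[X in expR X]opprK expRN invf_ple ?posrE ?expR_gt0 //; lra.
have -> : expR 1 = expR (1 / 2) * expR (1 / 2) :> R.
  by rewrite -expRD; congr expR; lra.
have := expR_gt0 (1 / 2 : R); nra.
Qed.

Lemma expRN1_le_half (R : realType) : expR (- 1) <= 1 / 2 :> R.
Proof.
rewrite expRN invf_ple ?posrE ?expR_gt0 //; last by lra.
by apply: le_trans (expR_ge1Dx _); lra.
Qed.

Lemma prune_disjoint_prob (R : realType) (T : finType) (F : {set {set T}})
    (n : nat) (p : R) (H : {set T}) :
  0 <= p <= 1 -> p ^+ 2 * n%:R <= 1 / 100 ->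
  (forall t, t \in F -> #|t| = 3) ->
  (forall x, (#|[set t in F | x \in t]| <= n)%N) ->
  \sum_(B : {set T} | prune F B :&: H == set0) bernoulli_weight p B
    <= 2 * expR (- (p * #|H|%:R / 20)).
Proof.
move=> p01 pn F3 Fn; have /andP[p0 p1] := p01.
pose h : R := #|H|%:R; have h0 : 0 <= h by rewrite ler0n.
have ph0 : 0 <= p * h by rewrite mulr_ge0.
pose X B := #|B :&: H|; pose Y B := #|meeting (max_packing F B) H|.
have EX : \sum_(B : {set T}) bernoulli_weight p B * expR (- 1) ^+ X B
    <= expR (- (p * h / 2)).
  rewrite bernoulli_weight_expr.
  (* [1 - p + p / e <= 1 - p / 2 <= exp (- p / 2)], as [1 / e <= 1 / 2]. *)
  apply: (@le_trans _ _ (expR (- (p / 2)) ^+ #|H|)).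
    have eN1 := expRN1_le_half R; have e0 := expR_gt0 (- 1 : R).
    rewrite lerXn2r ?nnegrE ?expR_ge0 //; first by nra.
    by apply: le_trans (expR_ge1Dx _); nra.
  by rewrite -expRM_natr le_eqVlt; apply/orP; left; apply/eqP; congr expR; rewrite /h; lra.
have EY : \sum_(B : {set T}) bernoulli_weight p B * expR 1 ^+ Y B
    <= expR (3 / 100 * (p * h)).
  have e1 : 1 <= expR 1 :> R by rewrite -[X in X <= _]expR0 ler_expR.
  apply: le_trans (bernoulli_weight_max_packing H p01 e1 F3) _.
  have e4 := expR1_le4 R; have p3 : 0 <= p ^+ 3 by rewrite exprn_ge0.
  (* The bound [e <= 4] gives [e - 1 <= 3], then [1 + x <= exp x]. *)
  apply: (@le_trans _ _ (expR (3 * p ^+ 3) ^+ #|meeting F H|)).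
    rewrite lerXn2r ?nnegrE ?expR_ge0 //; first by nra.
    by apply: le_trans (expR_ge1Dx _); nra.
  rewrite -expRM_natr ler_expR.
  have /(_ H) mF := card_meeting_le _ Fn.
  have {}mF : #|meeting F H|%:R <= n%:R * h by rewrite -natrM ler_nat.
  apply: (@le_trans _ _ (3 * p ^+ 3 * (n%:R * h))).
    by apply: ler_wpM2l mF; rewrite mulr_ge0.
  (* The hypothesis on [p ^+ 2 * n] absorbs the degree bound [n]. *)
  have -> : 3 * p ^+ 3 * (n%:R * h) = 3 * (p ^+ 2 * n%:R) * (p * h) by ring.
  by apply: ler_wpM2r => //; lra.
(* Markov's inequality for both exponential moments at once. *)
apply: (@le_trans _ _ (\sum_(B : {set T}) (bernoulli_weight p B * expR (- 1) ^+ X B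
     * expR (p * h / 4) + bernoulli_weight p B * expR 1 ^+ Y B * expR (- (p * h / 12))))).
  rewrite big_mkcond /=; apply: ler_sum => B _.
  have w0 := bernoulli_weight_ge0 B p01.
  rewrite -![bernoulli_weight p B * _ * _]mulrA -mulrDr -!expRM_natr -!expRD.
  case: ifPn => [/eqP B0|_]; last by rewrite mulr_ge0 // addr_ge0 ?expR_ge0.
  rewrite -[X in X <= _]mulr1; apply: ler_wpM2l => //.
  have XY : (X B)%:R <= 3 * (Y B)%:R :> R.
    rewrite -natrM ler_nat; apply: card_setI_prune_disjoint => // t tF.
    by rewrite F3.
  have eX := expR_gt0 (- 1 * (X B)%:R + p * h / 4).
  have eY := expR_gt0 (1 * (Y B)%:R + - (p * h / 12)).
  (* For small [X] the first summand is at least 1; otherwise [Y >= X / 3 > p * h / 12] and the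
     second one is. *)
  have [Xs|Xl] := lerP (X B)%:R (p * h / 4).
    have : 1 <= expR (- 1 * (X B)%:R + p * h / 4).
      by rewrite -[X in X <= _]expR0 ler_expR; lra.
    lra.
  have : 1 <= expR (1 * (Y B)%:R + - (p * h / 12)).
    by rewrite -[X in X <= _]expR0 ler_expR; lra.
  lra.
rewrite big_split /= -!mulr_suml.
have -> : 2 * expR (- (p * h / 20)) = expR (- (p * h / 20)) + expR (- (p * h / 20)) by ring.
(* In units of [p * h] the exponents are [-1/2 + 1/4 = -1/4] and [3/100 - 1/12 = -4/75], both below
   [-1/20]. *)
apply: lerD.
  apply: (@le_trans _ _ (expR (- (p * h / 2)) * expR (p * h / 4))).
    by apply: ler_wpM2r => //; apply: expR_ge0.
  by rewrite -expRD ler_expR; lra.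
apply: (@le_trans _ _ (expR (3 / 100 * (p * h)) * expR (- (p * h / 12)))).
  by apply: ler_wpM2r => //; apply: expR_ge0.
by rewrite -expRD ler_expR; lra.
Qed.

(** * Triangles of the complete graph *)

Definition pairs_in (n : nat) (W : {set 'I_n}) : {set {set 'I_n}} :=
  [set e : {set 'I_n} | e \subset W & #|e| == 2].

(** Triangles are sets of three edges, so disjointness in [packing] means edge-disjointness. *)
Definition triangles (n : nat) : {set {set {set 'I_n}}} :=
  [set pairs_in W | W in [set W : {set 'I_n} | #|W| == 3]].

Lemma card_triangles_edge (n : nat) (t : {set {set 'I_n}}) :
  t \in triangles n -> #|t| = 3.
Proof. by case/imsetP => W; rewrite inE => /eqP W3 ->; rewrite cards_draws W3. Qed.

(** A triangle through [e] is determined by its third vertex [z]. *)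
Lemma triangles_degree (n : nat) (e : {set 'I_n}) :
  (#|[set t in triangles n | e \in t]| <= n)%N.
Proof.
apply: (@leq_trans #|[set pairs_in (z |: e) | z : 'I_n]|); last first.
  by apply: leq_trans (leq_imset_card _ _) _; rewrite card_ord.
apply/subset_leq_card/subsetP => t; rewrite inE => /andP[/imsetP[W]].
rewrite inE => /eqP W3 ->; rewrite inE => /andP[eW /eqP e2].
have /cards1P[z zW] : #|W :\: e| == 1.
  by rewrite cardsD (setIidPr eW) W3 e2.
apply/imsetP; exists z => //; congr pairs_in.
by rewrite -zW setUC -{1}(setIidPr eW) setID.
Qed.

(** The cardinalities encode that the vertices are distinct. A pair missing [x] or [y] is the
    opposite edge; otherwise it is [[set x; y]]. *)
Lemma pairs_in3 (n : nat) (x y z : 'I_n) (e : {set 'I_n}) :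
  e \in pairs_in [set x; y; z] ->
  #|[set x; y]| = 2 -> #|[set y; z]| = 2 -> #|[set x; z]| = 2 ->
  [|| e == [set x; y], e == [set y; z] | e == [set x; z]].
Proof.
rewrite inE => /andP[eW /eqP e2] xy yz xz.
have sub a b : #|[set a; b]| = 2 -> e \subset [set a; b] -> e == [set a; b].
  by move=> ab eab; rewrite eqEcard eab ab e2.
have D a : a \notin e -> e \subset [set x; y; z] :\ a by rewrite subsetD1 eW.
have [xe|/D xe] := boolP (x \in e); last first.
  rewrite (sub y z) ?orbT //; apply: subset_trans xe _; apply/subsetP => w.
  by rewrite !inE => /andP[/negPf ->].
have [ye|/D ye] := boolP (y \in e); last first.
  rewrite (sub x z) ?orbT //; apply: subset_trans ye _; apply/subsetP => w.
  by rewrite !inE => /andP[/negPf ->]; rewrite orbF.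
by rewrite [e == _]eq_sym eqEcard xy e2 leqnn subUset !sub1set xe ye.
Qed.

Lemma two_sets_only (n : nat) (B : {set {set 'I_n}}) :
  [forall e in [set e in B | #|e| == 2], #|e| == 2].
Proof. by apply/forall_inP => e; rewrite inE => /andP[]. Qed.

(** Sampling runs over all sets of vertices; those that are not pairs are discarded here, which does
    not affect disjointness from a graph. *)
Definition graph_of (n : nat) (B : {set {set 'I_n}}) : sgraph n :=
  SGraph (two_sets_only B).

Lemma card_edge (n : nat) (G : sgraph n) (e : {set 'I_n}) :
  e \in edges G -> #|e| = 2.
Proof. by case: G => E /= /forall_inP E2 /E2/eqP. Qed.

Lemma graph_of_disjoint (n : nat) (B : {set {set 'I_n}}) (H : sgraph n) :
  edge_disjoint (graph_of B) H = (B :&: edges H == set0).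
Proof.
congr (_ == _); apply/setP => e; rewrite !inE -andbA; congr (_ && _).
by apply: andb_idl => /card_edge ->.
Qed.

Lemma graph_of_prune_triangle_free (n : nat) (B : {set {set 'I_n}}) :
  triangle_free (graph_of (prune (triangles n) B)).
Proof.
move=> x y z; apply/negP; set E := prune _ B => /and3P[].
have edgeE e : e \in edges (graph_of E) -> e \in E /\ #|e| = 2.
  by rewrite inE => /andP[eE /eqP].
move=> /edgeE[xyE xy] /edgeE[yzE yz] /edgeE[xzE xz].
have W3 : #|[set x; y; z]| == 3.
  rewrite [_ :|: [set z]]setUC cardsU1 !inE ![z == _]eq_sym.
  move: xy yz xz; rewrite !cards2.
  by case: (x == y); case: (y == z); case: (x == z).
have tT : pairs_in [set x; y; z] \in triangles n by apply: imset_f; rewrite inE.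
have /(prune_free B tT)/negP : pairs_in [set x; y; z] != set0.
  by rewrite -card_gt0 (card_triangles_edge tT).
apply; apply/subsetP => e /pairs_in3 /(_ xy yz xz).
by case/or3P => /eqP ->.
Qed.

(** * Averaging over the random graph *)

Theorem theorem4p1 (R : realType) :
  exists delta : R, 0 < delta /\
  exists N : nat, forall n : nat, (N <= n)%N ->
  forall a : sgraph n -> R,
    (forall H : sgraph n, 0 <= a H) ->
    \sum_(H : sgraph n)
      a H * expR (- (delta * (nb_edges H)%:R / Num.sqrt n%:R)) < 1 / 2 ->
    exists G : sgraph n,
      triangle_free G /\
      \sum_(H : sgraph n | edge_disjoint G H) a H < 1.
Proof.
(* With [p = 1 / (10 sqrt n)], the exponent [p * e(H) / 20] equals [e(H) / (200 sqrt n)]. *)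
exists (1 / 200); split; first by lra.
exists 1%N => n n1 a a0 aH.
pose r : R := Num.sqrt n%:R.
have rr : r ^+ 2 = n%:R by rewrite sqr_sqrtr ?ler0n.
have r1 : 1 <= r by rewrite -[1]sqrtr1 ler_wsqrtr // ler1n.
have r0 : 0 < r by lra.
pose p := r^-1 / 10.
have rV1 : r^-1 <= 1 by rewrite invf_le1.
have rV0 : 0 < r^-1 by rewrite invr_gt0.
have p01 : 0 <= p <= 1 by apply/andP; split; rewrite /p; lra.
have pn : p ^+ 2 * n%:R <= 1 / 100.
  rewrite -rr /p le_eqVlt; apply/orP; left; apply/eqP; field.
  by rewrite gt_eqF.
pose Gr B := graph_of (prune (triangles n) B).
suff [B GB] : exists B, \sum_(H | edge_disjoint (Gr B) H) a H < 1.
  by exists (Gr B); split => //; apply: graph_of_prune_triangle_free.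
(* If every [B] fails, the weighted average of the sums is at least 1, while the tail bound makes it
   at most twice the sum in the hypothesis. *)
apply/existsP; apply: contraTT aH; rewrite negb_exists => /forallP no.
rewrite -leNgt.
have : 1 <= \sum_(B : {set {set 'I_n}})
    \sum_(H | edge_disjoint (Gr B) H) bernoulli_weight p B * a H.
  rewrite -[X in X <= _](@sum_bernoulli_weight _ {set 'I_n} p); apply: ler_sum => B _.
  rewrite -mulr_sumr -[X in X <= _]mulr1 ler_wpM2l ?bernoulli_weight_ge0 //.
  by rewrite leNgt.
rewrite (exchange_big_dep xpredT) //= => le1.
suff : \sum_H \sum_(B | edge_disjoint (Gr B) H) bernoulli_weight p B * a H
    <= 2 * \sum_H a H * expR (- (1 / 200 * (nb_edges H)%:R / r)) by lra.
(* After the exchange, the factor of [a H] is the probability that the pruned graph misses [H]. *)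
rewrite mulr_sumr; apply: ler_sum => H _.
rewrite -mulr_suml mulrCA mulrC; apply: ler_wpM2l => //.
under eq_bigl => B do rewrite graph_of_disjoint.
apply: le_trans (prune_disjoint_prob _ p01 pn (@card_triangles_edge n)
  (@triangles_degree n)) _.
rewrite le_eqVlt; apply/orP; left; apply/eqP; congr (_ * expR _).
by rewrite /p /nb_edges; lra.
Qed.
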